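(* Let $q$ be a prime power. A self-dual $[4,2,3]_q$ code exists if and only if $q\notin\{2,5\}$.
   Context: $\mathbb{F}_q$ is the finite field of order $q$. An $[n,k,d]_q$ code $C$ is a $k$-dimensional linear subspace of $\mathbb{F}_q^n$ with minimum Hamming distance $d$. The dual is $C^\perp=\{\mathbf{x}\in\mathbb{F}_q^n : \mathbf{x}\cdot\mathbf{v}=0\ \forall \mathbf{v}\in C\}$ with respect to the Euclidean inner product $\mathbf{v}\cdot\mathbf{u}=\sum_{i=1}^n v_iu_i$, and $C$ is self-dual if $C=C^\perp$. *)

(* Defs.v *)
From HB Require Import structures.
From mathcomp Require Import all_boot all_order all_algebra.

Set Implicit Arguments.
Unset Strict Implicit.
Unset Printing Implicit Defensive.

Import GRing.Theory.

Local Open Scope ring_scope.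

Definition prime_power (q : nat) : Prop :=
  exists p m : nat, [/\ prime p, (0 < m)%N & q = (p ^ m)%N].

(* Linear codes of length n over F are the elements of {vspace 'rV[F]_n}. *)
Section LinearCodes.

Variables (F : finFieldType) (n : nat).

Implicit Types (u v x : 'rV[F]_n) (C : {vspace 'rV[F]_n}).

Definition dotp u v : F := \sum_(i < n) u 0 i * v 0 i.

Definition hamming_dist u v : nat := #|[set i : 'I_n | u 0 i != v 0 i]|.

(* A code with a single codeword has no minimum distance: the predicate then
   fails for every d. *)
Definition has_min_dist C (d : nat) : Prop :=
  (exists u v, [/\ u \in C, v \in C, u != v & hamming_dist u v = d]) /\
  (forall u v, u \in C -> v \in C -> u != v -> (d <= hamming_dist u v)%N).

Definition is_code C (k d : nat) : Prop := \dim C = k /\ has_min_dist C d.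

(* dotp with its second argument fixed, as a linear form valued in the vector
   space F^o. *)
Definition dotpr v x : F^o := dotp x v.

Lemma dotpr_is_linear v : linear (dotpr v).
Proof.
move=> a x y; rewrite /dotpr /dotp scaler_sumr -big_split /=.
by apply: eq_bigr => i _; rewrite !mxE mulrDl -mulrA.
Qed.

HB.instance Definition _ v :=
  GRing.isLinear.Build F 'rV[F]_n F^o _ (dotpr v) (dotpr_is_linear v).

Definition dual_code C : {vspace 'rV[F]_n} :=
  (\bigcap_(v in C) lker (linfun (dotpr v)))%VS.

Lemma dual_codeP C x :
  reflect (forall v, v \in C -> dotp x v = 0) (x \in dual_code C).
Proof.
rewrite memvE; apply: (iffP subv_bigcapP) => H v Cv.
  by have := H v Cv; rewrite -memvE memv_ker lfunE => /eqP.
by rewrite -memvE memv_ker lfunE /= /dotpr H.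
Qed.

Definition self_dual C : Prop := C = dual_code C.

End LinearCodes.

(* Main.v *)
Require Import Defs.
From mathcomp Require Import all_boot all_order all_algebra.
From mathcomp Require Import finfield ring.

(** A self-dual [4,2,3] code over F exists exactly when -1 = a^2 + b^2 with a
    and b both nonzero.  In one direction, a two-dimensional code contains a
    nonzero word x that vanishes at a prescribed position; minimum distance 3
    makes the other three coordinates nonzero, and x.x = 0 says that the sum of
    their squares vanishes ([self_dual_code_sum2sq]).  In the other direction,
    the rows (1, 0, a, b) and (0, 1, -b, a) generate such a code
    ([sum2sq_self_dual_code]).

    It remains to solve a^2 + b^2 = -1 with a b <> 0.
    - In characteristic 2, b = a + 1 works for any a other than 0 and 1, and
      such an a is missing only if F has two elements.
    - In odd characteristic, if -1 = i^2, the conic a^2 + b^2 = -1 splits as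
      (a + i b)(a - i b) = -1 and is parametrised by t = a + i b; the condition
      a b <> 0 reads t^4 <> 1, and can be met unless F = {0, 1, -1, i, -i}, a
      field with five elements.
    - In odd characteristic, if -1 is not a square, any solution has
      a b <> 0, and one exists because the squares and their reflection
      y |-> -1 - y are too numerous to be disjoint ([sum2sqN1]).

    Over the fields with 2 and 5 elements the nonzero squares are 1, and 1 and
    -1, respectively, so that a^2 + b^2 + 1 = 0 would force 3 = 0 or 1 = 0. *)

Set Implicit Arguments.
Unset Strict Implicit.
Unset Printing Implicit Defensive.

Import GRing.Theory.

Local Open Scope ring_scope.

(** * Sums of two nonzero squares in a finite field *)

Definition nz_sum2sqN1 (F : finFieldType) : Prop :=
  exists a b : F, [/\ a != 0, b != 0 & a ^+ 2 + b ^+ 2 + 1 = 0].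

(** A nonzero square has at most two roots, while 0 has only one: this missing
    root gives the strict inequality. *)
Lemma card_squares (F : finFieldType) :
  (#|F| < 2 * #|[set x ^+ 2 | x : F]|)%N.
Proof.
set S := [set _ | _ in _].
have S0 : (0 : F) \in S by apply/imsetP; exists 0; rewrite // expr0n.
rewrite -[X in (X < _)%N]sum1_card.
rewrite (partition_big_imset (fun x : F => x ^+ 2)) /= -/S.
rewrite (bigD1 (0 : F)) //= (cardsD1 (0 : F)) S0 mulnDr.
rewrite -addSn leq_add //.
  rewrite sum1_card muln1 ltnS.
  rewrite -[X in (_ <= X)%N](card1 (0 : F)) subset_leq_card //.
  by apply/subsetP => x; rewrite !inE -sqrf_eq0.
rewrite mulnC -sum_nat_const.
rewrite [X in (_ <= X)%N](eq_bigl (fun y => (y \in S) && (y != 0))); last first.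
  by move=> y; rewrite !inE andbC.
apply: leq_sum => y /andP[/imsetP[r _ ->] _].
rewrite sum1_card (leq_trans _ (card_size [:: r; - r])) //.
by rewrite subset_leq_card //; apply/subsetP => x; rewrite !inE -eqf_sqr.
Qed.

(** If -1 were not a sum of two squares, the squares and their image under the
    injection y |-> -1 - y would be disjoint, against [card_squares]. *)
Lemma sum2sqN1 (F : finFieldType) : exists a b : F, a ^+ 2 + b ^+ 2 + 1 = 0.
Proof.
pose S := [set x ^+ 2 | x : F]; pose T := [set - 1 - y | y in S].
have cT : #|T| = #|S| by apply: card_imset => y z /addrI /oppr_inj.
case: (boolP [disjoint S & T]) => [dST | /pred0Pn[y /andP[]]].
  have := card_squares F; rewrite -/S mul2n -addnn -{2}cT.
  by rewrite -cardsUI (disjoint_setI0 dST) cards0 addn0 ltnNge max_card.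
move=> /imsetP[a _ ->] /imsetP[_ /imsetP[b _ ->] eab].
by exists a, b; rewrite eab; ring.
Qed.

Lemma card_uniq_cover (T : finType) (s : seq T) :
  uniq s -> (forall x, x \in s) -> #|T| = size s.
Proof. by move=> /card_uniqP <- sT; apply: eq_card => x; rewrite sT. Qed.

Lemma nz_sum2sqN1_char2 (F : finFieldType) :
  2 = 0 :> F -> #|F| <> 2 -> nz_sum2sqN1 F.
Proof.
move=> c2 q2; case: (pickP (fun a : F => a \notin [:: 0; 1])) => [a | no].
  rewrite !inE negb_or => /andP[a0 a1]; exists a, (a - 1); split=> //.
    by rewrite subr_eq0.
  have -> : a ^+ 2 + (a - 1) ^+ 2 + 1 = 2 * (a ^+ 2 - a + 1) by ring.
  by rewrite c2 mul0r.
case: q2; apply: (@card_uniq_cover _ [:: 0; 1]) => [|x].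
  by rewrite /= !inE eq_sym oner_eq0.
exact/negbFE/no.
Qed.

Lemma nz_sum2sqN1_sqrtN1 (F : finFieldType) (i : F) :
  2 != 0 :> F -> i ^+ 2 = - 1 -> #|F| <> 5 -> nz_sum2sqN1 F.
Proof.
move=> c2 ii q5.
have i0 : i != 0 by rewrite -sqrf_eq0 ii oppr_eq0 oner_eq0.
have nN (x : F) : x != 0 -> x != - x.
  by move=> x0; rewrite -subr_eq0 opprK -mulr2n -mulr_natl mulf_neq0.
case: (pickP (fun t : F => t \notin [:: 0; 1; - 1; i; - i])) => [t | no].
  rewrite !inE !negb_or => /and5P[t0 t1 tN1 ti tNi].
  (* The point with a + i b = t and a - i b = - t^-1. *)
  exists ((t ^+ 2 - 1) / (2 * t)), ((t ^+ 2 + 1) / (2 * i * t)).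
  have d0 : 2 * t != 0 by rewrite mulf_neq0.
  have e0 : 2 * i * t != 0 by rewrite !mulf_neq0.
  split.
  - by rewrite mulf_neq0 ?invr_eq0 // subr_sqr_1 mulf_neq0 ?subr_eq0 ?addr_eq0.
  - rewrite mulf_neq0 ?invr_eq0 //.
    have -> : t ^+ 2 + 1 = (t - i) * (t + i).
      by rewrite -subr_sqr ii opprK.
    by rewrite mulf_neq0 ?subr_eq0 ?addr_eq0.
  - rewrite !expr_div_n !exprMn ii.
    have c4 : 4 != 0 :> F by rewrite (natrM F 2 2) mulf_neq0.
    by field; rewrite t0 oppr_eq0 c4.
case: q5; apply: (@card_uniq_cover _ [:: 0; 1; - 1; i; - i]) => [|x].
  have n1 : i != 1.
    by apply: contraTneq (nN 1 (oner_neq0 _)) => i1; rewrite -ii i1 expr1n eqxx.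
  have nN1 : i != - 1.
    apply: contraTneq (nN 1 (oner_neq0 _)) => i1.
    by rewrite -ii i1 sqrrN expr1n eqxx.
  rewrite /= !inE ![0 == _]eq_sym !oppr_eq0 oner_eq0 (negPf i0) /=.
  rewrite (negPf (nN _ i0)) (negPf (nN _ (oner_neq0 _))) /=.
  by rewrite eqr_opp ![1 == _]eq_sym ![- 1 == _]eq_sym eqr_oppLR !negb_or n1 nN1.
exact/negbFE/no.
Qed.

Lemma nz_sum2sqN1_nsqrtN1 (F : finFieldType) :
  (forall i : F, i ^+ 2 != - 1) -> nz_sum2sqN1 F.
Proof.
move=> nsq; have [a [b eab]] := sum2sqN1 F.
exists a, b; split=> //.
  apply: contraNneq (nsq b) => a0.
  by rewrite -addr_eq0 -eab a0 expr0n add0r.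
apply: contraNneq (nsq a) => b0.
by rewrite -addr_eq0 -eab b0 expr0n addr0.
Qed.

Lemma card_nz_sum2sqN1 (F : finFieldType) :
  #|F| <> 2 -> #|F| <> 5 -> nz_sum2sqN1 F.
Proof.
move=> q2 q5; have [c2 | c2] := eqVneq (2 : F) 0.
  exact: nz_sum2sqN1_char2.
case: (pickP (fun i : F => i ^+ 2 == - 1)) => [i /eqP ii | no].
  exact: nz_sum2sqN1_sqrtN1 ii q5.
by apply: nz_sum2sqN1_nsqrtN1 => i; rewrite no.
Qed.

Lemma natr_card_eq0 (F : finFieldType) p :
  prime p -> #|F| = p -> p%:R = 0 :> F.
Proof.
move=> pp cF; have /(_ _ pp) pF := @card_finPcharP F p 1.
by apply: pcharf0; apply: pF; rewrite cF expn1.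
Qed.

Lemma nz_sum2sqN1_card2 (F : finFieldType) : #|F| = 2 -> ~ nz_sum2sqN1 F.
Proof.
move=> cF [a [b [a0 b0]]].
have sq1 (x : F) : x != 0 -> x ^+ 2 = 1.
  move=> x0; have x2 : x ^+ 2 = x by have := expf_card x; rewrite cF.
  by rewrite x2; apply: (mulIf x0); rewrite mul1r -expr2.
have two0 : 1 + 1 = 0 :> F := natr_card_eq0 (isT : prime 2) cF.
by rewrite !sq1 // two0 add0r => /eqP; rewrite oner_eq0.
Qed.

Lemma nz_sum2sqN1_card5 (F : finFieldType) : #|F| = 5 -> ~ nz_sum2sqN1 F.
Proof.
move=> cF [a [b [a0 b0 eab]]].
have five0 : 5 = 0 :> F := natr_card_eq0 (isT : prime 5) cF.
have sq1 (x : F) : x != 0 -> x ^+ 2 = 1 \/ x ^+ 2 = - 1.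
  move=> x0; have x4 : x ^+ 4 = 1.
    by apply: (mulIf x0); rewrite mul1r -exprSr -[RHS]expf_card cF.
  have /eqP : (x ^+ 2) ^+ 2 = 1 by rewrite -exprM.
  by rewrite sqrf_eq1 => /orP[] /eqP; [left | right].
have n1 : (1 : F) <> 0 by apply/eqP/oner_neq0.
apply: n1.
case: (sq1 a a0) (sq1 b b0) eab => -> [] -> e.
- have -> : 1 = 2 * (1 + 1 + 1) - 5 :> F by ring.
  by rewrite e five0 mulr0 subr0.
- by rewrite -e; ring.
- by rewrite -e; ring.
- have -> : 1 = - (- 1 + - 1 + 1) :> F by ring.
  by rewrite e oppr0.
Qed.

(** * From the code to the sum of squares, and back *)

Section Codes.

Variable F : finFieldType.

Lemma hamming_distE n (u v : 'rV[F]_n) :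
  hamming_dist u v = (\sum_(i < n) ((u - v)%R 0%R i != 0%R :> F))%N.
Proof.
rewrite /hamming_dist cardsE -sum1_card big_mkcond /=.
apply: eq_bigr => i _; rewrite !mxE subr_eq0 unfold_in /=.
by case: (_ != _).
Qed.

Lemma sum_ord4 (V : nmodType) (f : 'I_4 -> V) :
  \sum_(i < 4) f i = f 0 + f 1 + f 2%:R + f 3%:R.
Proof.
rewrite !big_ord_recr big_ord0 /= add0r.
by congr (f _ + f _ + f _ + f _); apply/val_inj.
Qed.

(** Evaluation at a position is a linear form, hence has a nonzero kernel on
    any space of dimension at least 2. *)
Lemma codeword_zero_at n (C : {vspace 'rV[F]_n}) (i : 'I_n) :
  (1 < \dim C)%N -> exists x, [/\ x \in C, x != 0 & x 0 i = 0].
Proof.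
move=> dC; pose f := linfun (dotpr (delta_mx 0 i : 'rV[F]_n)).
have kC : (C :&: lker f)%VS != 0%VS.
  apply: contraTneq dC => k0; rewrite -(limg_ker_dim f C) k0 dimv0 add0n.
  by rewrite -leqNgt (leq_trans (dimvS (subvf _))) // dimvf.
exists (vpick (C :&: lker f)); have := memv_pick (C :&: lker f).
rewrite memv_cap memv_ker lfunE => /andP[xC /eqP fx].
split=> //; first by rewrite vpick0.
move: fx; rewrite /= /dotpr /dotp (bigD1 i) //= big1 => [|j ji].
  by rewrite !mxE !eqxx mulr1 addr0.
by rewrite !mxE (negPf ji) andbF mulr0.
Qed.

(** A nonzero word vanishing at position 0 has weight 3 and is orthogonal to
    itself; dividing by its last coordinate gives a and b. *)
Lemma self_dual_code_sum2sq (C : {vspace 'rV[F]_4}) :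
  is_code C 2 3 -> self_dual C -> nz_sum2sqN1 F.
Proof.
case=> dC [_ minC] sC.
have [|x [xC x0 xi]] := @codeword_zero_at 4 C 0; first by rewrite dC.
have := minC x 0 xC (mem0v C) x0; rewrite hamming_distE subr0 sum_ord4 xi eqxx.
case: eqP => // /eqP x1; case: eqP => // /eqP x2; case: eqP => // /eqP x3 _.
have xD : x \in dual_code C by rewrite -sC.
have := dual_codeP _ _ xD x xC; rewrite /dotp sum_ord4 xi mulr0 add0r => xx.
exists (x 0 1 / x 0 3%:R), (x 0 2%:R / x 0 3%:R).
split; rewrite ?mulf_neq0 ?invr_eq0 //.
apply: (mulIf (mulf_neq0 x3 x3)); rewrite mul0r -xx.
by field.
Qed.

Section Construction.

Variables a b : F.
Hypotheses (a0 : a != 0) (b0 : b != 0) (eab : a ^+ 2 + b ^+ 2 + 1 = 0).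

(** The combination s (1, 0, a, b) + t (0, 1, -b, a), in coordinates. *)
Definition sum2sq_word (s t : F) : 'rV[F]_4 :=
  \row_i [:: s; t; a * s - b * t; b * s + a * t]`_i.

Definition sum2sq_code : {vspace 'rV[F]_4} :=
  <<[:: sum2sq_word 1%R 0%R; sum2sq_word 0%R 1%R]>>%VS.

Lemma sum2sq_wordP (s t : F) (x : 'rV[F]_4) :
  reflect [/\ x 0 0 = s, x 0 1 = t, x 0 2%:R = a * s - b * t
            & x 0 3%:R = b * s + a * t] (x == sum2sq_word s t).
Proof.
apply: (iffP eqP) => [-> | [x0 x1 x2 x3]]; first by rewrite !mxE.
apply/rowP => i; rewrite mxE.
case: i => [[|[|[|[|//]]]] lti] /=;
  [rewrite -x0 | rewrite -x1 | rewrite -x2 | rewrite -x3];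
  by congr (x _ _); apply/val_inj.
Qed.

Lemma sum2sq_word_lin (s t : F) :
  sum2sq_word s t = s *: sum2sq_word 1 0 + t *: sum2sq_word 0 1.
Proof.
apply/esym/eqP/sum2sq_wordP; rewrite !mxE /=.
by split; ring.
Qed.

Lemma mem_sum2sq_code (x : 'rV[F]_4) :
  reflect (exists s t, x = sum2sq_word s t) (x \in sum2sq_code).
Proof.
rewrite /sum2sq_code span_cons span_seq1.
apply: (iffP memv_addP) => [[_ /vlineP[s ->] [_ /vlineP[t ->] ->]] | [s [t ->]]].
  by exists s, t; rewrite [RHS]sum2sq_word_lin.
exists (s *: sum2sq_word 1 0); first by rewrite memvZ ?memv_line.
exists (t *: sum2sq_word 0 1); first by rewrite memvZ ?memv_line.
exact: sum2sq_word_lin.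
Qed.

Lemma dim_sum2sq_code : \dim sum2sq_code = 2.
Proof.
have nz (x : 'rV[F]_4) i : x 0 i = 1 -> x != 0.
  by move=> xi; apply: contra_eq_neq xi => ->; rewrite mxE eq_sym oner_neq0.
suff /eqnP : free [:: sum2sq_word 1 0; sum2sq_word 0 1] by [].
rewrite free_cons span_seq1 seq1_free (nz _ 1) ?mxE // andbT.
apply/negP => /vlineP[k] /rowP /(_ 0) /eqP.
by rewrite !mxE /= mulr0 oner_eq0.
Qed.

(** Two vanishing coordinates force the word to vanish; for the last two this
    is the invertibility of the matrix with rows (a, -b) and (b, a), whose
    determinant is -1. *)
Lemma sum2sq_word_weight (s t : F) : sum2sq_word s t != 0 ->
  (3 <= \sum_(i < 4) (sum2sq_word s t 0%R i != 0%R :> F))%N.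
Proof.
move=> nz; rewrite sum_ord4 !mxE /=.
have [s0 | s0] := eqVneq s 0.
  have t0 : t != 0.
    apply: contraNneq nz => t0; apply/eqP/rowP => i; rewrite !mxE s0 t0.
    by case: i => [[|[|[|[|//]]]] lti] /=; rewrite ?mulr0 ?subr0 ?addr0.
  rewrite s0 !mulr0 sub0r [0 + a * t]add0r oppr_eq0.
  by rewrite t0 (mulf_neq0 b0 t0) (mulf_neq0 a0 t0).
have [t0 | t0] := eqVneq t 0.
  rewrite t0 !mulr0 subr0 [b * s + 0]addr0.
  by rewrite (mulf_neq0 a0 s0) (mulf_neq0 b0 s0).
have [e2 | //] := eqVneq (a * s - b * t) 0.
have [e3 | //] := eqVneq (b * s + a * t) 0.
have : s = (a ^+ 2 + b ^+ 2 + 1) * s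
           - (a * (a * s - b * t) + b * (b * s + a * t)) by ring.
by rewrite eab e2 e3 !mulr0 mul0r addr0 subr0 => /eqP; rewrite (negPf s0).
Qed.

Lemma min_dist_sum2sq_code : has_min_dist sum2sq_code 3.
Proof.
split; last first.
  move=> u v uC vC; rewrite hamming_distE -subr_eq0.
  have /mem_sum2sq_code[s [t ->]] := memvB uC vC.
  exact: sum2sq_word_weight.
have nz : sum2sq_word 1 0 != 0.
  by apply/eqP => /rowP /(_ 0) /eqP; rewrite !mxE oner_eq0.
exists (sum2sq_word 1 0), 0; rewrite mem0v; split=> //.
  by apply/mem_sum2sq_code; exists 1, 0.
rewrite hamming_distE subr0 sum_ord4 !mxE /= !mulr0 !mulr1 subr0 addr0.
by rewrite a0 b0 oner_neq0 eqxx.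
Qed.

Lemma self_dual_sum2sq_code : self_dual sum2sq_code.
Proof.
apply/vspaceP => x; apply/mem_sum2sq_code/dual_codeP.
  move=> [s [t ->]] _ /mem_sum2sq_code[s' [t' ->]].
  rewrite /dotp sum_ord4 !mxE /=.
  transitivity ((a ^+ 2 + b ^+ 2 + 1) * (s * s' + t * t')); first by ring.
  by rewrite eab mul0r.
move=> xD; exists (x 0 0), (x 0 1).
have dx s t : dotp x (sum2sq_word s t) = 0.
  by apply: xD; apply/mem_sum2sq_code; exists s, t.
(* The combinations of the two parity checks that isolate the last two
   coordinates. *)
have := dx a (- b); have := dx b a.
rewrite /dotp !sum_ord4 !mxE /= => e3 e2; apply/eqP/sum2sq_wordP; split=> //.
  apply/eqP; rewrite -subr_eq0 -oppr_eq0 -e2; apply/eqP.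
  transitivity (x 0 0 * a - x 0 1 * b + (a ^+ 2 + b ^+ 2 + 1 - 1) * x 0 2%:R).
    by rewrite eab; ring.
  by ring.
apply/eqP; rewrite -subr_eq0 -oppr_eq0 -e3; apply/eqP.
transitivity (x 0 0 * b + x 0 1 * a + (a ^+ 2 + b ^+ 2 + 1 - 1) * x 0 3%:R).
  by rewrite eab; ring.
by ring.
Qed.

End Construction.

Lemma sum2sq_self_dual_code :
  nz_sum2sqN1 F -> exists C : {vspace 'rV[F]_4}, is_code C 2 3 /\ self_dual C.
Proof.
move=> [a [b [a0 b0 eab]]]; exists (sum2sq_code a b).
split; last exact: self_dual_sum2sq_code.
by split; [apply: dim_sum2sq_code | apply: min_dist_sum2sq_code].
Qed.

End Codes.

Local Close Scope ring_scope.

Theorem corollary9 (q : nat) (hq : prime_power q) (F : finFieldType)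
    (hF : #|F| = q) :
  (exists C : {vspace 'rV[F]_4}, is_code C 2 3 /\ self_dual C) <->
  q \notin [:: 2; 5].
Proof.
split=> [[C [cC sC]] | q25].
  have S := self_dual_code_sum2sq cC sC.
  rewrite !inE; apply/norP; split; apply/eqP => q_eq; rewrite q_eq in hF.
    exact: nz_sum2sqN1_card2 S.
  exact: nz_sum2sqN1_card5 S.
move: q25; rewrite !inE => /norP[/eqP q2 /eqP q5].
by apply: sum2sq_self_dual_code; apply: card_nz_sum2sqN1; rewrite hF.
Qed.
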